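(* For $0\le k\le p$, $m\in\{-p+2k+1,\dots,\kappa-p-1\}\cup\{\kappa-p+2k+1,\dots,2\kappa-p-1\}$, and any integer $n$, $$f^{(k)}_{m,n}=q^{pn-km-k(k+1)}\,(q^{m+p-k}-q^{-m-p+k})\begin{bmatrix}p\\ k\end{bmatrix}^{-1}\Psi^{(k)}(q^{-1},-m-p+k,-n-1).$$
   Context: $\kappa,p$ are non-negative integers with $\kappa\ge2p+2$; $q=e^{\pi i/\kappa}$, $q^c=e^{\pi ic/\kappa}$; $[n]=\frac{q^n-q^{-n}}{q-q^{-1}}$, $[n]!=[1][2]\cdots[n]$ ($[0]!=1$), $\begin{bmatrix}n\\ j\end{bmatrix}=\frac{[n]!}{[j]![n-j]!}$, $(n,q)_j=[n][n+1]\cdots[n+j-1]$ ($(n,q)_0=1$). Coefficients: $$f_{m,n}^{(k)}=\frac{q^{-m(n+k)-\frac{k(k+1)}2}}{(q^{-1}-q)^k}\begin{bmatrix}p\\ k\end{bmatrix}^{-1}\sum_{j=0}^k\begin{bmatrix}k\\ j\end{bmatrix}\frac{q^{2jn}}{(-m-p+k+1,q)_j\,(m+p-k+1,q)_{k-j}}.$$ Trace functions of $U_q(sl_2)$: $\psi^{(k)}(q,\nu,\mu)$ denotes the (scalar) weighted trace $\operatorname{Tr}|_{M_\mu}(\varPhi_\mu^u q^{\nu h})$, where $M_\mu$ is the Verma module over $U_q(sl_2)$ of highest weight $\mu$ with highest weight vector $v_\mu$, $U$ is the irreducible module of highest weight $2k$, $u\in U[0]$ lies in its (one-dimensional) zero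 weight space, and $\varPhi_\mu^u:M_\mu\to M_\mu\otimes U$ is the intertwiner with $\varPhi^u_\mu v_\mu=\sum_{j\ge0}\frac{F^jv_\mu}{[j]!\,(-\mu,q)_j}\otimes E^ju$; the trace is identified with a scalar by $\operatorname{End}(U[0])=\mathbb C$. By a known formula it equals $$\psi^{(k)}(q,\nu,\mu)=q^{\nu\mu}\sum_{j=0}^{k}(-1)^jq^{\frac{j(j-3)}2}(q-q^{-1})^{-j-1}\frac{[k+j]!}{[j]![k-j]!}\,\frac{q^{-j\mu-(j-1)\nu}}{\prod_{l=0}^{j-1}[\mu-l]\,\prod_{l=0}^{j}[\nu-l]},$$ and this formula may be taken as its definition. The renormalized trace function is $$\Psi^{(k)}(q,\nu,\mu)=\prod_{j=1}^k\left(\frac{q^{\mu+1-j}-q^{-\mu-1+j}}{q^{\nu+j}-q^{-\nu-j}}\right)\psi^{(k)}(q,\nu,\mu).$$ It is holomorphic in $\mu$ (the factors $[\mu-l]$ in the denominators cancel), and at integer $\mu$ it is evaluated after this cancellation. $\Psi^{(k)}(q^{-1},\nu,\mu)$ is obtained by replacing $q$ with $q^{-1}$ (i.e. $q^c$ with $q^{-c}$) everywhere in these formulas. *)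

(* Defs.v *)
From mathcomp Require Import all_boot all_order all_algebra.
From mathcomp Require Import complex.
From mathcomp Require Import reals sequences exp trigo.
From mathcomp Require Import ring.

Set Implicit Arguments.
Unset Strict Implicit.
Unset Printing Implicit Defensive.

Import Order.TTheory GRing.Theory Num.Theory.
Local Open Scope ring_scope.
Local Open Scope complex_scope.

Definition expC (R : realType) (z : R[i]) : R[i] :=
  let: x +i* y := z in (expR x * cos y) +i* (expR x * sin y).

(* All q-quantities are parametrised by a chosen logarithm t of q, so that the
   powers q^c are unambiguous for every complex exponent c.  Replacing q by
   q^-1, i.e. each q^c by q^(-c), amounts to replacing t by - t (qpowN). *)
Definition logq (R : realType) (kappa : nat) : R[i] := 0 +i* (pi / kappa%:R).

Section QAnalogues.
Variables (R : realType) (t : R[i]).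
Implicit Types (c nu mu : R[i]) (j k p : nat) (m n : int).

Definition qpow c : R[i] := expC (t * c).

Definition qnum c : R[i] := (qpow c - qpow (- c)) / (qpow 1 - qpow (- 1)).

Definition qfact j : R[i] := \prod_(1 <= i < j.+1) qnum i%:R.

(* Only meaningful for j <= k, because of the truncated subtraction. *)
Definition qbinom k j : R[i] := qfact k / (qfact j * qfact (k - j)).

Definition qpoch c j : R[i] := \prod_(0 <= i < j) qnum (c + i%:R).

Definition fcoef p k m n : R[i] :=
  let M : R[i] := m%:~R in let N : R[i] := n%:~R in
  let P : R[i] := p%:R in let K : R[i] := k%:R in
  qpow (- M * (N + K) - K * (K + 1) / 2) / (qpow (- 1) - qpow 1) ^+ k
  * (qbinom p k)^-1
  * \sum_(0 <= j < k.+1)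
      qbinom k j * (qpow (2 * j%:R * N)
        / (qpoch (- M - P + K + 1) j * qpoch (M + P - K + 1) (k - j))).

Definition psi k nu mu : R[i] :=
  qpow (nu * mu) *
  \sum_(0 <= j < k.+1)
    (-1) ^+ j * qpow (j%:R * (j%:R - 3) / 2)
    * (qpow 1 - qpow (- 1)) ^- j.+1
    * (qfact (k + j) / (qfact j * qfact (k - j)))
    * (qpow (- j%:R * mu - (j%:R - 1) * nu)
       / ((\prod_(0 <= l < j) qnum (mu - l%:R))
          * \prod_(0 <= l < j.+1) qnum (nu - l%:R))).

(* The renormalised trace function as a meromorphic expression; since
   x / 0 = 0 it does not have the intended value where some [mu - l] is 0. *)
Definition Psi_mero k nu mu : R[i] :=
  (\prod_(1 <= j < k.+1)
     ((qpow (mu + 1 - j%:R) - qpow (- mu - 1 + j%:R))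
      / (qpow (nu + j%:R) - qpow (- nu - j%:R))))
  * psi k nu mu.

(* The same expression after cancelling the factors [mu - l], 0 <= l < j, of
   the j-th summand against the first j factors of the prefactor; each
   (q^(mu - l) - q^(- mu + l)) / [mu - l] leaves a factor q - q^-1.  The
   result is entire in mu, and equals Psi_mero off the poles (PsiE). *)
Definition Psi k nu mu : R[i] :=
  qpow (nu * mu) / (\prod_(1 <= j < k.+1) (qpow (nu + j%:R) - qpow (- nu - j%:R)))
  * \sum_(0 <= j < k.+1)
    (-1) ^+ j * qpow (j%:R * (j%:R - 3) / 2)
    * (qpow 1 - qpow (- 1)) ^- j.+1
    * (qfact (k + j) / (qfact j * qfact (k - j)))
    * (qpow (- j%:R * mu - (j%:R - 1) * nu)
       * (qpow 1 - qpow (- 1)) ^+ j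
       * (\prod_(j.+1 <= i < k.+1)
            (qpow (mu + 1 - i%:R) - qpow (- mu - 1 + i%:R)))
       / \prod_(0 <= l < j.+1) qnum (nu - l%:R)).

Lemma PsiE k nu mu :
  (forall l : nat, (l < k)%N -> qnum (mu - l%:R) != 0) ->
  Psi k nu mu = Psi_mero k nu mu.
Proof.
move=> nz; rewrite /Psi /Psi_mero /psi.
set D := \prod_(1 <= j < k.+1) (qpow (nu + _) - _).
set G := fun i : nat => qpow (mu + 1 - i%:R) - qpow (- mu - 1 + i%:R).
have -> : \prod_(1 <= j < k.+1) (G j / (qpow (nu + j%:R) - qpow (- nu - j%:R)))
   = (\prod_(1 <= j < k.+1) G j) / D by rewrite big_split /= prodfV.
rewrite -mulrA [RHS]mulrCA -!mulrA; congr (_ * _).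
rewrite [RHS]mulrCA; congr (_ * _).
rewrite mulr_sumr; apply: eq_big_nat => j /andP[_]; rewrite ltnS => jk.
rewrite (@big_cat_nat _ _ _ j.+1 1 k.+1) //=.
have -> : \prod_(1 <= i < j.+1) G i
  = (qpow 1 - qpow (- 1)) ^+ j * \prod_(0 <= l < j) qnum (mu - l%:R).
  rewrite big_add1 /= -[X in _ ^+ X](subn0 j) -prodr_const_nat -big_split /=.
  apply: eq_big_nat => l /andP[_ lj].
  have := nz l (leq_trans lj jk); rewrite /qnum mulf_eq0 invr_eq0 negb_or.
  case/andP=> _ d0; rewrite mulrC divfK // /G -addn1 natrD.
  by congr (qpow _ - qpow _); ring.
have nz' : \prod_(0 <= l < j) qnum (mu - l%:R) != 0.
  rewrite prodf_seq_neq0; apply/allP => l; rewrite mem_index_iota => /andP[_ lj].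
  exact: nz (leq_trans lj jk).
have cancel (a b c d w s A C B : R[i]) : A != 0 ->
  a * b * c * d * (w * s * C / B) = s * A * C * (a * b * c * d * (w / (A * B))).
  by move=> A0; rewrite invfM -[LHS]mul1r -(divff A0); ring.
by rewrite (cancel _ _ _ _ _ _ _ _ _ nz').
Qed.

End QAnalogues.

Lemma qpowN (R : realType) (t c : R[i]) : qpow (- t) c = qpow t (- c).
Proof. by rewrite /qpow mulNr mulrN. Qed.

(* Main.v *)
Require Import Defs.
From mathcomp Require Import all_boot all_order all_algebra.
From mathcomp Require Import complex.
From mathcomp Require Import reals sequences exp trigo.
From mathcomp Require Import ring zify.

Import Order.TTheory GRing.Theory Num.Theory.
Local Open Scope ring_scope.
Local Open Scope complex_scope.

(** Write a = m + p - k, [c] = qnum t c and (c)_j = qpoch t c j.  The prefactors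
of the two sides are powers of q and products of q-numbers, so the content of
the theorem is an identity between two sums over 0 <= j <= k: on the left a
polynomial in q^(2n) with coefficients [k choose j] / ((1-a)_j (1+a)_(k-j)), on
the right a combination of the products over j < i <= k of q^(n+i) - q^(-n-i).
It is a terminating case of Jackson's transformation of a 2phi1 into a 2phi2.

It is proved by comparing coefficients of q^(2rn).  The q-binomial theorem
expands each product on the right (qbinomial_theorem).  After the two summations
are exchanged, the symmetry of the q-trinomial coefficient (gauss_trinomial)
pulls [k choose r] out of the inner sum, and what is left is the terminating
q-Chu-Vandermonde sum (qvandermonde) with n = k - r, b = k + 1 and c = a + 1.
The value of that sum contains (a-k)_(k-r) / (a+1)_(k-r), which is, up to the
factor (a-k)_k and a sign, the left-hand coefficient, because
(a-k)_k = (a-k)_(k-r) (a-r)_r and (1-a)_r = (-1)^r (a-r)_r.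

All this holds for an arbitrary logarithm t of q, as long as the q-numbers in the denominators do not vanish (fcoef_eq_Psi).  For
q = e^(pi i / kappa) these denominators involve only [i] with 0 < i <= k and
[a + i] with -k <= i <= k.  The two ranges allowed for m say exactly that a + i
stays strictly inside (0, kappa) or (kappa, 2 kappa), where
sin (pi (a + i) / kappa) is nonzero. *)

(** * Powers of q and q-numbers *)

Lemma expCD (R : realType) (x y : R[i]) : expC (x + y) = expC x * expC y.
Proof.
case: x => a b; case: y => c d; rewrite /expC /=.
apply/eqP; rewrite eq_complex /= expRD cosD sinD.
by apply/andP; split; apply/eqP; ring.
Qed.

Lemma expC0 (R : realType) : expC (0 : R[i]) = 1.
Proof. by apply/eqP; rewrite eq_complex /= expR0 cos0 sin0 !mul1r !eqxx. Qed.

Section QCalculus.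
Variables (R : realType) (t : R[i]).
Implicit Types (a b c x y : R[i]) (f : nat -> R[i]).
Local Notation q := (qpow t).
Local Notation qd := (qpow t 1 - qpow t (- 1)).

Lemma qpowD x y : q (x + y) = q x * q y.
Proof. by rewrite /qpow mulrDr expCD. Qed.

Lemma qpow0 : q 0 = 1.
Proof. by rewrite /qpow mulr0 expC0. Qed.

Lemma qnumN x : qnum t (- x) = - qnum t x.
Proof. by rewrite /qnum opprK -opprB mulNr. Qed.

(** A q-number is invariant under q <-> q^-1: both its numerator and its
denominator change sign. *)
Lemma qnum_tN x : qnum (- t) x = qnum t x.
Proof.
rewrite /qnum !qpowN !opprK -[in LHS]opprB.
by rewrite -[X in _ / X]opprB invrN mulrNN.
Qed.

(** This addition formula is the only property of q-numbers behind the q-Pascal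
rule and the induction step of the q-Vandermonde sum. *)
Lemma qnumD x y : qnum t (x + y) = q y * qnum t x + q (- x) * qnum t y.
Proof.
by rewrite /qnum !mulrA -mulrDl; congr (_ / _); rewrite opprD !qpowD; ring.
Qed.

Lemma qnumK x : qd != 0 -> q x - q (- x) = qd * qnum t x.
Proof. by move=> d0; rewrite /qnum mulrC divfK. Qed.

Lemma qpoch0 c : qpoch t c 0 = 1.
Proof. by rewrite /qpoch big_geq. Qed.

Lemma qpochS c j : qpoch t c j.+1 = qpoch t c j * qnum t (c + j%:R).
Proof. by rewrite /qpoch big_nat_recr. Qed.

Lemma qpochSl c j : qpoch t c j.+1 = qnum t c * qpoch t (c + 1) j.
Proof.
rewrite /qpoch big_nat_recl //= addr0; congr (_ * _).
by apply: eq_bigr => i _; rewrite -addn1 natrD; congr (qnum _ _); ring.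
Qed.

Lemma qpoch_neq0 c j :
  (forall i : nat, (i < j)%N -> qnum t (c + i%:R) != 0) -> qpoch t c j != 0.
Proof.
move=> nz; rewrite /qpoch prodf_seq_neq0; apply/allP => i.
by rewrite mem_index_iota => /andP[_ ij]; exact: nz.
Qed.

Lemma qpoch_cat c i j :
  qpoch t c (i + j) = qpoch t c i * qpoch t (c + i%:R) j.
Proof.
elim: j => [|j IH]; first by rewrite addn0 qpoch0 mulr1.
by rewrite addnS !qpochS IH natrD mulrA addrA.
Qed.

(** The factors [i - c] with 1 <= i <= j are the opposites of the factors of
(c - j)_j, in reverse order. *)
Lemma qpoch_opp c j : qpoch t (1 - c) j = (-1) ^+ j * qpoch t (c - j%:R) j.
Proof.
elim: j => [|j IH]; first by rewrite !qpoch0 expr0 mulr1.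
rewrite qpochS IH qpochSl -[1 - c + _]opprK qnumN exprS.
rewrite -[j.+1%:R]natr1.
have -> : - (1 - c + j%:R) = c - (j%:R + 1) :> R[i] by ring.
have -> : c - (j%:R + 1) + 1 = c - j%:R :> R[i] by ring.
by ring.
Qed.

Lemma qfactS j : qfact t j.+1 = qfact t j * qnum t j.+1%:R.
Proof. by rewrite /qfact big_nat_recr. Qed.

Lemma qfactE j : qfact t j = qpoch t 1 j.
Proof.
elim: j => [|j IH]; first by rewrite qpoch0 /qfact big_geq.
by rewrite qfactS qpochS IH addrC natr1.
Qed.

Lemma qfactD k j : qfact t (k + j) = qfact t k * qpoch t (k%:R + 1) j.
Proof. by rewrite !qfactE qpoch_cat addrC. Qed.

Lemma qfact_neq0 n :
  (forall i : nat, (0 < i <= n)%N -> qnum t i%:R != 0) -> qfact t n != 0.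
Proof.
move=> nz; rewrite qfactE; apply: qpoch_neq0 => i ni.
by rewrite addrC natr1 nz.
Qed.

(** * Gaussian binomials *)

(** The Gaussian binomial is defined by the q-Pascal rule rather than by a
quotient of q-factorials: it then vanishes for j > n, so that sums over j may
be taken over any longer range, and the q-binomial theorem needs no
nonvanishing hypothesis on q-numbers. *)
Fixpoint gauss (n j : nat) : R[i] :=
  match n, j with
  | _, 0 => 1
  | 0, _.+1 => 0
  | n'.+1, j'.+1 =>
      q j'.+1%:R * gauss n' j'.+1 + q (j'%:R - n'%:R) * gauss n' j'
  end.

Lemma gauss0r n : gauss n 0 = 1. Proof. by case: n. Qed.

Lemma gauss_small n j : (n < j)%N -> gauss n j = 0.
Proof.
elim: n j => [|n IH] [|j] //= nj.
by rewrite !IH ?mulr0 ?addr0 // ltnW.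
Qed.

Lemma gauss_fact n j : (j <= n)%N ->
  gauss n j * (qfact t j * qfact t (n - j)) = qfact t n.
Proof.
elim: n j => [|n IH] [|j] //=.
- by rewrite /qfact !big_geq // !mulr1.
- by rewrite subn0 {1}/qfact big_geq // !mul1r.
rewrite ltnS subSS => jn.
have IHj := IH j jn.
have [jn'|] := ltnP j n; last first.
  move=> nj; have E : j = n by apply/eqP; rewrite eqn_leq jn nj.
  rewrite gauss_small ?E // mulr0 add0r subrr qpow0 mul1r.
  by rewrite qfactS mulrAC mulrA -{2}IHj E mulrAC mulrA.
have IHj1 := IH j.+1 jn'.
have E : (n - j = (n - j.+1).+1)%N by lia.
have X : qfact t n.+1 = qfact t n *
     (q j.+1%:R * qnum t (n - j)%:R + q (j%:R - n%:R) * qnum t j.+1%:R).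
  rewrite qfactS -(opprB n%:R) -natrB // -qnumD -natrD.
  by congr (_ * qnum _ _%:R); lia.
rewrite X mulrDr -{1}IHj1 -IHj qfactS E [qfact t (n - j.+1).+1]qfactS.
by ring.
Qed.

Lemma qbinomE n j : qfact t n != 0 -> (j <= n)%N ->
  qbinom t n j = gauss n j.
Proof.
move=> n0 jn; have E := gauss_fact _ _ jn.
rewrite /qbinom -[in LHS]E mulfK //.
by apply: contraNneq n0 => E0; rewrite -E E0 mulr0.
Qed.

(** For i + j <= k both sides are [k]! / ([i]! [j]! [k-i-j]!); otherwise both
vanish. *)
Lemma gauss_trinomial k i j : qfact t k != 0 -> (i <= k)%N -> (j <= k)%N ->
  gauss k i * gauss (k - i) j = gauss k j * gauss (k - j) i.
Proof.
move=> k0 ik jk.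
have [ijk|kij] := leqP (i + j) k; last first.
  by rewrite (gauss_small (k - i) j) ?(gauss_small (k - j) i) ?mulr0 //; lia.
have Ei := gauss_fact _ _ ik; have Ej := gauss_fact _ _ jk.
have Eij : gauss (k - i) j * (qfact t j * qfact t (k - i - j))
   = qfact t (k - i) by apply: gauss_fact; lia.
have Eji : gauss (k - j) i * (qfact t i * qfact t (k - i - j))
   = qfact t (k - j).
  by have -> : (k - i - j = k - j - i)%N by [lia]; apply: gauss_fact; lia.
have nz : qfact t i * qfact t j * qfact t (k - i - j) != 0.
  apply: contraNneq k0 => E0; rewrite -Ei -Eij.
  have -> : gauss k i * (qfact t i * (gauss (k - i) j * (qfact t j *
     qfact t (k - i - j)))) = gauss k i * gauss (k - i) j *
     (qfact t i * qfact t j * qfact t (k - i - j)) by ring.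
  by rewrite E0 mulr0.
apply: (mulIf nz); transitivity (qfact t k).
  by rewrite -Ei -Eij; ring.
by rewrite -Ej -Eji; ring.
Qed.

(** The q-Pascal rule summed against a weight: the induction step of both the
q-binomial theorem and the q-Vandermonde sum. *)
Lemma gauss_sumS n f :
  \sum_(0 <= j < n.+2) gauss n.+1 j * f j =
  \sum_(0 <= j < n.+1) gauss n j * (q j%:R * f j + q (j%:R - n%:R) * f j.+1).
Proof.
rewrite big_nat_recl //= mul1r.
under eq_bigr do rewrite mulrDl.
rewrite big_split /= addrA.
under [RHS]eq_bigr do rewrite mulrDr.
rewrite [RHS]big_split /=; congr (_ + _); last first.
  by apply: eq_bigr => j _; ring.
rewrite big_nat_recr //= gauss_small // mulr0 mul0r addr0.
rewrite [RHS]big_nat_recl //= gauss0r qpow0 !mul1r; congr (_ + _).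
by apply: eq_bigr => j _; ring.
Qed.

Lemma gauss_sum_widen n k f : (n <= k)%N ->
  \sum_(0 <= j < k.+1) gauss n j * f j = \sum_(0 <= j < n.+1) gauss n j * f j.
Proof.
move=> nk; rewrite (@big_cat_nat _ _ _ n.+1 0 k.+1) //=.
rewrite [X in _ + X]big_nat [X in _ + X]big1 ?addr0 // => j /andP[nj _].
by rewrite gauss_small ?mul0r.
Qed.

(** * The q-binomial theorem and the q-Vandermonde sum *)

(** The factors only change sign under q <-> q^-1, so the powers of q gather
around the midpoint y + (N + 1) / 2 of the exponents y + 1, ..., y + N.  The induction
splits off the first factor, which replaces y by y + 1. *)
Lemma qbinomial_theorem N y :
  \prod_(0 <= i < N) (q (y + i.+1%:R) - q (- y - i.+1%:R)) =
  \sum_(0 <= r < N.+1) gauss N r *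
    ((-1) ^+ (N + r) * q ((2 * r%:R - N%:R) * (y + (N%:R + 1) / 2))).
Proof.
elim: N y => [|N IH] y.
  by rewrite big_geq // big_nat1 /= mulr0 subr0 mul0r qpow0 !mulr1.
rewrite big_nat_recl // gauss_sumS.
under eq_bigr => i _.
  have -> : y + i.+2%:R = (y + 1) + i.+1%:R by rewrite -[i.+2%:R]natr1; ring.
  have -> : - y - i.+2%:R = - (y + 1) - i.+1%:R
    by rewrite -[i.+2%:R]natr1; ring.
  over.
rewrite IH mulr_sumr; apply: eq_bigr => r _.
rewrite mulrCA; congr (_ * _).
rewrite !addSn addnS !exprS; set S := (-1) ^+ _; set Q := q ((_ - N%:R) * _).
have -> : q (r%:R - N%:R) * (-1 * (-1 * S) *
    q ((2 * r.+1%:R - N.+1%:R) * (y + (N.+1%:R + 1) / 2)))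
  = S * (q (y + 1) * Q).
  rewrite mulrCA -qpowD -qpowD mulrA !mulN1r opprK mul1r; congr (_ * q _).
  by rewrite -[N.+1%:R]natr1 -[r.+1%:R]natr1; field.
have -> : q r%:R * (-1 * S *
    q ((2 * r%:R - N.+1%:R) * (y + (N.+1%:R + 1) / 2)))
  = - (S * (q (- y - 1) * Q)).
  rewrite mulrCA -qpowD -qpowD mulN1r mulNr; congr (- (_ * q _)).
  by rewrite -[N.+1%:R]natr1; field.
by ring.
Qed.

(** The terminating q-Chu-Vandermonde sum.  The weight q^(j (1 - n + b - c)) is
the one for which the q-Pascal rule splits the sum for n + 1 into a sum for n
with the same (b, c) and one with (b + 1, c + 1), so the induction has to be
uniform in b and c. *)
Lemma qvandermonde n b c :
  (forall i : nat, (i < n)%N -> qnum t (c + i%:R) != 0) ->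
  \sum_(0 <= j < n.+1) gauss n j *
    ((-1) ^+ j * q (j%:R * (1 - n%:R + b - c)) * (qpoch t b j / qpoch t c j))
  = q (b * n%:R) * (qpoch t (c - b) n / qpoch t c n).
Proof.
elim: n b c => [|n IH] b c nz.
  by rewrite big_nat1 /= !qpoch0 mul0r mulr0 qpow0 divr1 !mulr1.
have nzn i : (i < n)%N -> qnum t (c + i%:R) != 0.
  by move=> ?; apply: nz; exact: ltnW.
have nzS i : (i < n)%N -> qnum t (c + 1 + i%:R) != 0.
  by move=> ?; rewrite -addrA nat1r; exact: nz.
rewrite gauss_sumS.
under eq_bigr do rewrite mulrDr.
rewrite big_split /=.
(* The terms with an unshifted index form the sum for (b, c). *)
have E1 : \sum_(0 <= j < n.+1) gauss n j * (q j%:R * ((-1) ^+ j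
    * q (j%:R * (1 - n.+1%:R + b - c)) * (qpoch t b j / qpoch t c j)))
   = q (b * n%:R) * (qpoch t (c - b) n / qpoch t c n).
  rewrite -IH //; apply: eq_bigr => j _; congr (_ * _).
  rewrite !mulrA [q j%:R * _]mulrC -[_ * q j%:R * _]mulrA -qpowD.
  by congr (_ * q _ * _ / _); rewrite -[n.+1%:R]natr1; ring.
(* The terms with a shifted index form the sum for (b + 1, c + 1). *)
have E2 : \sum_(0 <= j < n.+1) gauss n j * (q (j%:R - n%:R) * ((-1) ^+ j.+1
    * q (j.+1%:R * (1 - n.+1%:R + b - c))
    * (qpoch t b j.+1 / qpoch t c j.+1)))
   = - (q (- 2 * n%:R + b - c) * (qnum t b / qnum t c)) *
     (q ((b + 1) * n%:R) * (qpoch t (c - b) n / qpoch t (c + 1) n)).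
  have -> : c - b = (c + 1) - (b + 1) by ring.
  rewrite -IH // mulr_sumr; apply: eq_bigr => j _.
  rewrite [RHS]mulrCA; congr (_ * _).
  rewrite !qpochSl invfM exprS.
  have -> : q (j%:R - n%:R) * (-1 * (-1) ^+ j
      * q (j.+1%:R * (1 - n.+1%:R + b - c))
      * (qnum t b * qpoch t (b + 1) j
         * ((qnum t c)^-1 * (qpoch t (c + 1) j)^-1)))
    = - (-1) ^+ j * (q (j%:R - n%:R) * q (j.+1%:R * (1 - n.+1%:R + b - c)))
      * (qnum t b / qnum t c) * (qpoch t (b + 1) j / qpoch t (c + 1) j)
    by ring.
  have -> : q (j%:R - n%:R) * q (j.+1%:R * (1 - n.+1%:R + b - c))
    = q (- 2 * n%:R + b - c) * q (j%:R * (1 - n%:R + (b + 1) - (c + 1))).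
    by rewrite -!qpowD; congr (q _); rewrite -[n.+1%:R]natr1 -[j.+1%:R]natr1;
      ring.
  by ring.
rewrite E1 E2 qpochS.
have cn0 : qnum t (c + n%:R) != 0 by apply: nz.
have S := qpochSl c n; rewrite qpochS in S.
rewrite [in RHS]qpochS.
(* Over the common denominator (c)_(n+1), the two sums combine by the addition
   formula for (c - b + n) + b. *)
have key : qnum t (c + n%:R)
   = q b * qnum t (c - b + n%:R) + q (b - c - n%:R) * qnum t b.
  have -> : b - c - n%:R = - (c - b + n%:R) by ring.
  by rewrite -qnumD; congr (qnum _ _); ring.
have X1 : q (- 2 * n%:R + b - c) * q ((b + 1) * n%:R)
  = q (b - c - n%:R) * q (b * n%:R).
  by rewrite -!qpowD; congr (q _); ring.
have X2 : q (b * n.+1%:R) = q b * q (b * n%:R).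
  by rewrite -qpowD; congr (q _); rewrite -[n.+1%:R]natr1; ring.
have X3 : (qnum t c)^-1 / qpoch t (c + 1) n
    = (qpoch t c n * qnum t (c + n%:R))^-1 by rewrite S [RHS]invfM.
have X4 : (qpoch t c n)^-1
    = qnum t (c + n%:R) * (qpoch t c n * qnum t (c + n%:R))^-1.
  by rewrite invfM mulrCA divff // mulr1.
rewrite X2 X4.
transitivity (qpoch t (c - b) n * (q (b * n%:R) * qnum t (c + n%:R)
   - (q (- 2 * n%:R + b - c) * q ((b + 1) * n%:R)) * qnum t b)
   * (qpoch t c n * qnum t (c + n%:R))^-1).
  by rewrite -X3; ring.
by rewrite X1 {1}key; ring.
Qed.

(** * The transformation of the trace sum *)

(** The terminating Jackson transformation, by comparison of the coefficients
of q^(2rn). *)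
Lemma trace_sum_transform k n a :
  qfact t k != 0 -> qpoch t (a + 1) k != 0 ->
  \sum_(0 <= j < k.+1)
    gauss k j * (q (- (j%:R * (j%:R - 1) / 2) - j%:R * (n + a))
    * (qpoch t (k%:R + 1) j / qpoch t (a + 1) j)
    * \prod_(j.+1 <= i < k.+1) (q (n + i%:R) - q (- n - i%:R)))
  = (-1) ^+ k * q (k%:R * (k%:R + 1) / 2 - k%:R * n)
    * \sum_(0 <= r < k.+1) gauss k r * ((-1) ^+ r * q (2 * r%:R * n)
      * (qpoch t (a - k%:R) (k - r) / qpoch t (a + 1) (k - r))).
Proof.
move=> k0 a0.
have nza i : (i < k)%N -> qnum t (a + 1 + i%:R) != 0.
  move=> ik; apply: contraNneq a0 => E0; rewrite -(subnKC ik) qpoch_cat.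
  by rewrite qpochS E0 mulr0 mul0r.
(* The factor of G before (-1)^j collects the powers of q that depend on r
   only; what follows it is the summand of the q-Vandermonde sum. *)
pose G (j r : nat) := (-1) ^+ (k + r) * q (k%:R * (k%:R + 1) / 2 - k%:R * n)
  * q (2 * r%:R * n) * q (- (k%:R + 1) * (k - r)%:R) * ((-1) ^+ j
    * q (j%:R * (1 - (k - r)%:R + (k%:R + 1) - (a + 1)))
    * (qpoch t (k%:R + 1) j / qpoch t (a + 1) j)).
transitivity (\sum_(0 <= j < k.+1) \sum_(0 <= r < k.+1)
   gauss k j * gauss (k - j) r * G j r).
  apply: eq_big_nat => j /andP[_]; rewrite ltnS => jk.
  under [RHS]eq_bigr do rewrite -mulrA.
  rewrite -mulr_sumr; congr (_ * _).
  rewrite gauss_sum_widen ?leq_subr // -{1}(add0n j.+1) big_addn subSS.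
  under eq_bigr => i _.
    have -> : n + (i + j.+1)%:R = (n + j%:R) + i.+1%:R
      by rewrite natrD -!natr1; ring.
    have -> : - n - (i + j.+1)%:R = - (n + j%:R) - i.+1%:R
      by rewrite natrD -!natr1; ring.
    over.
  rewrite qbinomial_theorem mulr_sumr; apply: eq_big_nat => r /andP[_].
  rewrite ltnS => rkj; rewrite mulrCA; congr (_ * _).
  have rk : (r <= k)%N by apply: leq_trans rkj (leq_subr _ _).
  rewrite /G.
  have -> : (-1) ^+ (k - j + r) = (-1) ^+ (k + r) * (-1) ^+ j :> R[i].
    have -> : (k + r = k - j + r + j)%N by lia.
    by rewrite [in RHS]exprD -mulrA -expr2 sqrr_sign mulr1.
  set S := (-1) ^+ _; set S' := (-1) ^+ j; set Q := _ / qpoch t _ _.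
  have -> : forall u v, u * Q * (S * S' * v) = S * S' * Q * (u * v)
    by move=> *; ring.
  have -> : forall u v w z, S * u * v * w * (S' * z * Q)
     = S * S' * Q * (u * v * w * z) by move=> *; ring.
  by congr (_ * _); rewrite -!qpowD; congr (q _); rewrite !natrB //; field.
rewrite exchange_big_nat /= mulr_sumr; apply: eq_big_nat => r /andP[_].
rewrite ltnS => rk.
transitivity (gauss k r * \sum_(0 <= j < k.+1) gauss (k - r) j * G j r).
  rewrite mulr_sumr; apply: eq_big_nat => j /andP[_]; rewrite ltnS => jk.
  by rewrite gauss_trinomial // mulrA.
rewrite gauss_sum_widen ?leq_subr // mulrCA; congr (_ * _).
rewrite /G.
under eq_bigr do rewrite mulrCA.
rewrite -mulr_sumr qvandermonde; last first.
  by move=> i ik; apply: nza; apply: leq_trans ik (leq_subr _ _).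
have -> : a + 1 - (k%:R + 1) = a - k%:R by ring.
have E : q (- (k%:R + 1) * (k - r)%:R) * q ((k%:R + 1) * (k - r)%:R) = 1.
  by rewrite -qpowD mulNr addNr qpow0.
by rewrite exprD -[RHS]mulr1 -[X in _ = _ * X]E; ring.
Qed.

(** * The trace function at the inverse of q *)

Lemma prod_qpow_sub_qpoch a k : qd != 0 ->
  \prod_(1 <= j < k.+1) (q (a - j%:R) - q (- (a - j%:R)))
  = qd ^+ k * qpoch t (a - k%:R) k.
Proof.
move=> d0; elim: k => [|k IH]; first by rewrite big_geq // qpoch0 mul1r.
rewrite big_nat_recr //= IH qnumK // qpochSl exprSr.
have -> : a - k.+1%:R + 1 = a - k%:R by rewrite -[k.+1%:R]natr1; ring.
by ring.
Qed.

Lemma prod_qnum_opp a j :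
  \prod_(0 <= l < j) qnum t (- a - l%:R) = (-1) ^+ j * qpoch t a j.
Proof.
elim: j => [|j IH]; first by rewrite big_geq // qpoch0 mulr1.
by rewrite big_nat_recr //= IH -opprD qnumN qpochS exprS; ring.
Qed.

(** The j-th summand contributes (- d)^(- j - 1) and (- d)^j, with d = q - q^-1,
so a single factor d survives, and the sign of the product of the [- a - l]
absorbs (-1)^j. *)
Lemma Psi_oppE k a n : qd != 0 -> qfact t k != 0 -> qpoch t a k.+1 != 0 ->
  Psi (- t) k (- a) (- n - 1) =
  q (- a * n) / (qd ^+ k.+1 * qpoch t (a - k%:R) k * qnum t a)
  * \sum_(0 <= j < k.+1)
    gauss k j * (q (- (j%:R * (j%:R - 1) / 2) - j%:R * (n + a))
    * (qpoch t (k%:R + 1) j / qpoch t (a + 1) j)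
    * \prod_(j.+1 <= i < k.+1) (q (n + i%:R) - q (- n - i%:R))).
Proof.
move=> d0 k0 a0; rewrite /Psi.
under [X in _ / X]eq_bigr => j _.
  rewrite !qpowN.
  have -> : - (- a + j%:R) = a - j%:R by ring.
  have -> : - (- - a - j%:R) = - (a - j%:R) by ring.
  over.
rewrite prod_qpow_sub_qpoch // qpowN.
have -> : - (- a * (- n - 1)) = - a * n + - a by ring.
rewrite qpowD !mulr_sumr; apply: eq_big_nat => j /andP[_]; rewrite ltnS => jk.
have -> : qfact (- t) (k + j) / (qfact (- t) j * qfact (- t) (k - j))
    = gauss k j * qpoch t (k%:R + 1) j.
  have qfactN i : qfact (- t) i = qfact t i.
    by rewrite /qfact; apply: eq_bigr => l _; rewrite qnum_tN.
  by rewrite !qfactN qfactD mulrAC -[X in X * _]/(qbinom t k j) qbinomE.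
under eq_bigr => i _.
  rewrite !qpowN.
  have -> : - (- n - 1 + 1 - i%:R) = n + i%:R by ring.
  have -> : - (- (- n - 1) - 1 + i%:R) = - n - i%:R by ring.
  over.
have -> : \prod_(0 <= l < j.+1) qnum (- t) (- a - l%:R)
    = (-1) ^+ j.+1 * qpoch t a j.+1.
  by rewrite -prod_qnum_opp; apply: eq_bigr => l _; rewrite qnum_tN.
rewrite qpochSl !qpowN opprK.
have -> : q (- 1) - q 1 = - qd by ring.
have E : q (- a) * (q (- (j%:R * (j%:R - 3) / 2))
     * q (- (- j%:R * (- n - 1) - (j%:R - 1) * - a)))
   = q (- (j%:R * (j%:R - 1) / 2) - j%:R * (n + a)).
  by rewrite -!qpowD; congr (q _); field.
rewrite -E.
have a1 : qnum t a != 0.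
  by move: a0; rewrite qpochSl mulf_eq0 negb_or => /andP[].
set S := \prod_(_ <= i < _) _; set Z := qpoch t (a - _) _.
move: (qnum t a) a1 => A0 a1; set A := qpoch t (a + 1) j.
set Q1 := q (- a); set Q2 := q (- (_ / 2)); set Q3 := q (- (_ - _)).
have -> : (- qd) ^- j.+1 = - (- qd) ^- j / qd.
  by rewrite exprS invfM invrN mulrC mulrN mulNr.
have -> : ((-1) ^+ j.+1 * (A0 * A))^-1 = - (-1) ^+ j / (A0 * A).
  by rewrite invfM exprS mulN1r invrN invr_sign.
have X : (- qd) ^- j * (- qd) ^+ j = 1.
  by rewrite mulVf // expf_neq0 // oppr_eq0.
have Y : (-1) ^+ j * (-1) ^+ j = 1 :> R[i] by rewrite -expr2 sqrr_sign.
rewrite exprSr !invfM.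
set u := (- qd) ^- j in X *; set v := (- qd) ^+ j in X *.
set s := (-1) ^+ j in Y *.
set d := qd; set g := gauss k j; set w := qpoch t (k%:R + 1) j.
set N' := q (- a * n).
transitivity (N' * Q1 * (qd ^+ k)^-1 * Z^-1 * Q2 * d^-1 * g * w * Q3 * S
   * A0^-1 * A^-1 * (u * v) * (s * s)); last by rewrite X Y /d; ring.
by rewrite /d; ring.
Qed.

(** The theorem for an arbitrary logarithm t of q.  The product (a - K)_(2k + 1)
runs over the [a + i] with -k <= i <= k. *)
Lemma fcoef_eq_Psi p k m n :
  let M : R[i] := m%:~R in let N : R[i] := n%:~R in
  let P : R[i] := p%:R in let K : R[i] := k%:R in
  let a : R[i] := M + P - K in
  qfact t k != 0 -> qpoch t (a - K) (k + k.+1) != 0 ->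
  fcoef t p k m n =
    q (P * N - K * M - K * (K + 1)) * (q a - q (- a))
    * (qbinom t p k)^-1 * Psi (- t) k (- a) (- N - 1).
Proof.
move=> M N P K a k0; rewrite qpoch_cat subrK mulf_eq0 negb_or => /andP[Z0 A0].
have [a0 A1] : qnum t a != 0 /\ qpoch t (a + 1) k != 0.
  by move: A0; rewrite qpochSl mulf_eq0 negb_or => /andP[].
have d0 : qd != 0.
  by move: a0; rewrite /qnum mulf_eq0 negb_or invr_eq0 => /andP[].
rewrite Psi_oppE // trace_sum_transform // qnumK // /fcoef -/M -/N -/P -/K.
have -> : - M - P + K + 1 = 1 - a by rewrite /a; ring.
have -> : M + P - K + 1 = a + 1 by [].
set S := \sum_(_ <= j < _) _; set S' := \sum_(_ <= j < _) _.
(* (a - k)_(k - r) is turned into 1 / (1 - a)_r by completing it to (a - k)_k. *)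
have -> : S' = qpoch t (a - K) k * S.
  rewrite mulr_sumr; apply: eq_big_nat => r /andP[_]; rewrite ltnS => rk.
  rewrite qbinomE // qpoch_opp.
  have E : qpoch t (a - K) k = qpoch t (a - K) (k - r) * qpoch t (a - r%:R) r.
    rewrite -{1}(subnK rk) qpoch_cat natrB //.
    by congr (_ * qpoch _ _ _); rewrite /K; ring.
  have B0 : qpoch t (a - r%:R) r != 0.
    by move: Z0; rewrite E mulf_eq0 negb_or => /andP[].
  rewrite E !invfM invr_sign [RHS]mulrCA; congr (_ * _).
  rewrite -[LHS]mul1r -{1}(divff B0); ring.
have -> : ((q (- 1) - q 1) ^+ k)^-1 = (-1) ^+ k / qd ^+ k.
  by rewrite -[q (- 1) - _]opprB -[- qd]mulN1r exprMn invfM invr_sign.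
have E : q (- M * (N + K) - K * (K + 1) / 2)
  = q (P * N - K * M - K * (K + 1)) * q (- a * N)
    * q (K * (K + 1) / 2 - K * N).
  by rewrite -!qpowD; congr (q _); rewrite /a; field.
rewrite E -/K !exprSr; set B := (qbinom t p k)^-1.
set Z := qpoch t (a - K) k in Z0 *; set A := qnum t a in a0 *.
have dk0 : qd ^+ k != 0 by rewrite expf_neq0.
set D := qd ^+ k in dk0 *; set d := qd in d0 *.
by field; rewrite ?d0 ?dk0 ?Z0 ?a0.
Qed.

End QCalculus.

(** * Nonvanishing at q = e^(pi i / kappa) *)

(** The imaginary part is 2 sin (pi z / kappa), positive on the first interval
and negative on the second. *)
Lemma qpow_logq_sub_neq0 (R : realType) (kappa : nat) (z : int) :
  (0 < z < kappa%:Z) \/ (kappa%:Z < z < 2 * kappa%:Z) ->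
  qpow (logq R kappa) z%:~R - qpow (logq R kappa) (- z%:~R) != 0.
Proof.
move=> hz.
have k0 : (0 : R) < kappa%:R by rewrite ltr0n; lia.
have E (w : int) : qpow (logq R kappa) w%:~R
    = cos (pi * w%:~R / kappa%:R) +i* sin (pi * w%:~R / kappa%:R).
  rewrite /qpow /logq -[w%:~R in LHS](rmorph_int (real_complex R)) /=.
  apply/eqP; rewrite eq_complex /= !mulr0 !mul0r subr0 expR0 !mul1r add0r.
  by rewrite mulrAC !eqxx.
rewrite -rmorphN E E rmorphN /= eq_complex /= negb_and; apply/orP; right.
rewrite mulrN mulNr sinN opprK -mulr2n mulrn_eq0 /=.
have r (y : int) : 0 < y < kappa%:Z -> 0 < sin (pi * y%:~R / kappa%:R : R).
  move=> /andP[y0 yk]; apply: sin_gt0_pi; apply/andP; split.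
    by rewrite divr_gt0 // mulr_gt0 ?pi_gt0 // ltr0z.
  rewrite ltr_pdivrMr // ltr_pM2l ?pi_gt0 //.
  by rewrite -[kappa%:R]/(kappa%:~R) ltr_int.
case: hz => hz; first by rewrite gt_eqF // r.
have -> : pi * z%:~R / kappa%:R = pi * (z - kappa%:Z)%:~R / kappa%:R + pi :> R.
  by rewrite rmorphB /=; field; rewrite gt_eqF.
by rewrite sinDpi oppr_eq0 gt_eqF // r //; lia.
Qed.

Lemma qnum_logq_neq0 (R : realType) (kappa : nat) (z : int) :
  (0 < z < kappa%:Z) \/ (kappa%:Z < z < 2 * kappa%:Z) ->
  qnum (logq R kappa) z%:~R != 0.
Proof.
move=> hz; rewrite /qnum mulf_neq0 ?invr_eq0 ?qpow_logq_sub_neq0 //.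
rewrite (_ : 1 = 1%:~R) // qpow_logq_sub_neq0 //; lia.
Qed.

(** * The coefficients as values of the trace function *)

Theorem theorem8p1 (R : realType) (kappa p k : nat) (m n : int)
  (hkappa : (2 * p + 2 <= kappa)%N) (hk : (k <= p)%N)
  (hm : (- p%:Z + 2 * k%:Z + 1 <= m <= kappa%:Z - p%:Z - 1) \/
        (kappa%:Z - p%:Z + 2 * k%:Z + 1 <= m <= 2 * kappa%:Z - p%:Z - 1)) :
  let t : R[i] := logq R kappa in
  let M : R[i] := m%:~R in let N : R[i] := n%:~R in
  let P : R[i] := p%:R in let K : R[i] := k%:R in
  fcoef t p k m n =
    qpow t (P * N - K * M - K * (K + 1))
    * (qpow t (M + P - K) - qpow t (- M - P + K))
    * (qbinom t p k)^-1
    * Psi (- t) k (- M - P + K) (- N - 1).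
Proof.
move=> t M N P K.
have -> : - M - P + K = - (M + P - K) by ring.
apply: fcoef_eq_Psi.
  apply: qfact_neq0 => i ik; rewrite -[i%:R]/(i%:~R); apply: qnum_logq_neq0.
  by left; lia.
apply: qpoch_neq0 => i ik.
have -> : M + P - K - K + i%:R = (m + p%:Z - k%:Z - k%:Z + i%:Z)%:~R :> R[i].
  by rewrite !rmorphD /= !rmorphN.
apply: qnum_logq_neq0.
by case: hm => hm; [left | right]; lia.
Qed.
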